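(* Let $p,q\in\mathbb{Z}_+$, let $(a_{ij})_{0\le i\le p,\,0\le j\le q}$ be complex numbers, let $h_0,\dots,h_q\in\mathbb{R}$, and let $$L_h=\sum_{i=0}^{p}\sum_{j=0}^{q}a_{ij}\frac{d^i}{dx^i}\tau_{h_j}.$$ If every solution $f\in\mathcal{C}^p_{ub}$ of the homogeneous equation $L_hf=0$ is an almost automorphic function, then for every $S\in\mathcal{B}'_{aa}$, any solution $T\in\mathcal{D}'_{L^\infty}$ of the inhomogeneous equation $L_hT=S$ is an almost automorphic distribution.
   Context: All functions and distributions are complex-valued and defined on $\mathbb{R}$; $\mathcal{D}$ is the space of smooth compactly supported functions and $\mathcal{D}'$ the space of distributions. A continuous function $f:\mathbb{R}\to\mathbb{C}$ is almost automorphic if for every real sequence $(s_m)_{m\in\mathbb{N}}$ there is a subsequence $(s_{m_k})_k$ such that $g(x):=\lim_{k\to+\infty}f(x+s_{m_k})$ is well-defined for every $x\in\mathbb{R}$ and $\lim_{k\to+\infty}g(x-s_{m_k})=f(x)$ for every $x\in\mathbb{R}$. $\mathcal{C}_{aa}$ denotes the space of almost automorphic functions. $\mathcal{D}_{L^1}=\{\varphi\in\mathcal{C}^\infty:\ \varphi^{(i)}\in L^1\ \forall i\in\mathbb{Z}_+\}$ is a Fréchet space for the norms $|\varphi|_{m,1}=\sum_{i=0}^m\|\varphi^{(i)}\|_{L^1}$, $m\in\mathbb{Z}_+$, and $\mathcal{D}$ is dense in it. $\mathcal{D}'_{L^\infty}$ is the topological dual of $\mathcal{D}_{L^1}$, regarded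 as a subspace of $\mathcal{D}'$; its elements are called bounded distributions. For $\varphi\in\mathcal{D}$, $(T\ast\varphi)(x)=\langle T,\varphi(x-\cdot)\rangle$. A distribution $T\in\mathcal{D}'_{L^\infty}$ is called almost automorphic if it satisfies either of the following equivalent conditions: (i) $T\ast\varphi\in\mathcal{C}_{aa}$ for all $\varphi\in\mathcal{D}$; (ii) $T=\sum_{j=0}^kf_j^{(j)}$ for some $k\in\mathbb{Z}_+$ and $f_0,\dots,f_k\in\mathcal{C}_{aa}$ (distributional derivatives). $\mathcal{B}'_{aa}$ is the space of almost automorphic distributions. For $h\in\mathbb{R}$, $\tau_hf=f(\cdot+h)$ for functions, and $\langle\tau_hT,\varphi\rangle=\langle T,\tau_{-h}\varphi\rangle$ for distributions and $\varphi\in\mathcal{D}$. $\mathcal{C}^p_{ub}$ is the space of functions $\varphi$ of class $\mathcal{C}^p$ on $\mathbb{R}$ such that $\varphi^{(j)}$ is uniformly continuous and bounded on $\mathbb{R}$ for every $j\le p$. *)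

(* Defs.v *)
From HB Require Import structures.
From mathcomp Require Import all_boot all_order all_algebra.
From mathcomp Require Import complex.
From mathcomp Require Import all_classical all_reals all_analysis.
Set Implicit Arguments.
Unset Strict Implicit.
Unset Printing Implicit Defensive.
Import Order.TTheory GRing.Theory Num.Theory.
Import numFieldNormedType.Exports.
Local Open Scope classical_set_scope.
Local Open Scope ring_scope.
Local Open Scope complex_scope.

(* Complex values live in R[i]^o, the alias of R[i] on which MathComp-Analysis
   puts the topology, uniformity and norm of the field R[i]. *)
Definition cfun (R : realType) : Type := R -> R[i]^o.

Section Functions.
Context {R : realType}.
Implicit Types f g : cfun R.

(* R[i] is not a normed module over R, so derivatives of functions of a real
   variable are taken componentwise. *)
Definition cderivable f (x : R) : Prop :=
  derivable (fun y => complex.Re (f y)) x 1 /\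
  derivable (fun y => complex.Im (f y)) x 1.

Definition cderive f : cfun R := fun x =>
  derive1 (fun y => complex.Re (f y)) x +i*
  derive1 (fun y => complex.Im (f y)) x.

Definition cderiven (n : nat) f : cfun R := iter n cderive f.

Definition class_C (p : nat) f : Prop :=
  (forall j, (j < p)%N -> forall x, cderivable (cderiven j f) x) /\
  continuous (cderiven p f).

Definition smooth f : Prop := forall p, class_C p f.

Definition class_C_ub (p : nat) f : Prop :=
  class_C p f /\
  forall j, (j <= p)%N ->
    unif_continuous (cderiven j f) /\ bounded_fun (cderiven j f).

Definition shift_fun (h : R) f : cfun R := fun x => f (x + h).

Definition almost_automorphic f : Prop :=
  continuous f /\
  forall s : nat -> R, exists k : nat -> nat,
    {homo k : m n / (m < n)%N} /\
    exists g : cfun R, forall x,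
      f (x + s (k n)) @[n --> \oo] --> g x /\
      g (x - s (k n)) @[n --> \oo] --> f x.

Definition test_fun f : Prop :=
  smooth f /\ compact (closure [set x | f x != 0]).

Definition integrable_L1 f : Prop :=
  lebesgue_measure.-integrable [set: R] (fun x => (complex.Re (f x))%:E) /\
  lebesgue_measure.-integrable [set: R] (fun x => (complex.Im (f x))%:E).

Definition norm_L1 f : R :=
  \int[lebesgue_measure]_(x in [set: R]) ComplexField.Normc.normc (f x).

Definition D_L1 f : Prop := smooth f /\ forall i, integrable_L1 (cderiven i f).

Definition norm_D_L1 (m : nat) f : R :=
  \sum_(i < m.+1) norm_L1 (cderiven i f).

End Functions.

(* A functional is represented by a function on all of cfun R; its values
   matter only on D_L1, for bounded distributions, or on test_fun, for
   distributions. *)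
Definition functional (R : realType) : Type := cfun R -> R[i]^o.

Section Distributions.
Context {R : realType}.
Implicit Types (T S : functional R) (f phi psi : cfun R).

Definition linear_on_D_L1 T : Prop :=
  forall (c : R[i]) phi psi, D_L1 phi -> D_L1 psi ->
    T (fun x => c * phi x + psi x) = c * T phi + T psi.

(* The norms norm_D_L1 m increase with m, so their balls form bases of
   neighbourhoods for the topology of D_L1. *)
Definition continuous_on_D_L1 T : Prop :=
  forall phi, D_L1 phi -> forall e : R, 0 < e ->
    exists (m : nat) (d : R), 0 < d /\
      forall psi, D_L1 psi -> norm_D_L1 m (fun x => psi x - phi x) < d ->
        ComplexField.Normc.normc (T psi - T phi) < e.

Definition bounded_distribution T : Prop :=
  linear_on_D_L1 T /\ continuous_on_D_L1 T.

(* Test functions are dense in D_L1, so a bounded distribution is determined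
   by its restriction to them. *)
Definition eq_distribution T S : Prop :=
  forall phi, test_fun phi -> T phi = S phi.

Definition conv T phi : cfun R := fun x => T (fun y => phi (x - y)).

Definition aa_distribution T : Prop :=
  bounded_distribution T /\
  forall phi, test_fun phi -> almost_automorphic (conv T phi).

Definition shift_distr (h : R) T : functional R :=
  fun phi => T (shift_fun (- h) phi).

Definition derive_distr T : functional R := fun phi => - T (cderive phi).

Definition L_fun (p q : nat) (a : 'I_p.+1 -> 'I_q.+1 -> R[i])
    (h : 'I_q.+1 -> R) f : cfun R := fun x =>
  \sum_(i < p.+1) \sum_(j < q.+1) a i j * cderiven i (shift_fun (h j) f) x.

Definition L_distr (p q : nat) (a : 'I_p.+1 -> 'I_q.+1 -> R[i])
    (h : 'I_q.+1 -> R) T : functional R := fun phi =>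
  \sum_(i < p.+1) \sum_(j < q.+1)
     a i j * iter i derive_distr (shift_distr (h j) T) phi.

End Distributions.

(* Main.v *)
(* Fix a test function phi and put u = T * phi, v = S * phi, so that L_h u = v
   and all u^(j) are bounded and Lipschitz.  Given a sequence s, pass to a
   subsequence along which u(. + s_n) -> w and w(. - s_n) -> z, together with
   derivatives up to order p; then L_h z = v because v is almost automorphic, so
   r = z - u solves L_h r = 0 and is almost automorphic.  Refine the
   subsequence so that the double limit along s also sends r to r.  The double
   limit sends u + m r to u + (m + 1) r and does not increase the sup norm, so
   the functions u + m r are uniformly bounded in m, whence r = 0 and z = u. *)
Require Import Defs.
From mathcomp Require Import all_boot all_order all_algebra.
From mathcomp Require Import complex.
From mathcomp Require Import all_classical all_reals all_analysis.
From mathcomp Require Import zify ring lra.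
Import Order.TTheory GRing.Theory Num.Theory.
Import numFieldNormedType.Exports.
Import ComplexField.Normc.
Set Implicit Arguments.
Unset Strict Implicit.
Unset Printing Implicit Defensive.
Local Open Scope classical_set_scope.
Local Open Scope ring_scope.
Local Open Scope complex_scope.

(** * Modulus and convergence of complex values *)

Section ComplexValued.
Context {R : realType}.
Implicit Types (f g : cfun R) (F : nat -> cfun R) (z w : R[i]).

Lemma norm_normc z : `|z| = (normc z)%:C. Proof. by []. Qed.

Lemma normc_ge0 z : 0 <= normc z.
Proof. by case: z => a b; exact: sqrtr_ge0. Qed.

Lemma Re_le_normc z : `|complex.Re z| <= normc z.
Proof.
case: z => a b /=; rewrite -sqrtr_sqr ler_sqrt ?lerDl ?sqr_ge0//.
by rewrite addr_ge0 ?sqr_ge0.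
Qed.

Lemma Im_le_normc z : `|complex.Im z| <= normc z.
Proof.
case: z => a b /=; rewrite -sqrtr_sqr ler_sqrt ?lerDr ?sqr_ge0//.
by rewrite addr_ge0 ?sqr_ge0.
Qed.

Lemma normc_real (t : R) : normc t%:C = `|t|.
Proof. by rewrite /= expr0n addr0 sqrtr_sqr. Qed.

Lemma normc_le_ReIm z : normc z <= `|complex.Re z| + `|complex.Im z|.
Proof.
case: z => a b /=; rewrite -(ler_pXn2r (n := 2)) ?nnegrE ?sqrtr_ge0//.
  by rewrite sqr_sqrtr ?addr_ge0 ?sqr_ge0// sqrrD !real_normK ?num_real//
    addrAC lerDl mulrn_wge0// mulr_ge0.
Qed.

Lemma normc_le_trans z w : normc z <= normc (z - w) + normc w.
Proof. by rewrite -{1}(subrK w z) le_normcD. Qed.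

Lemma normcB z w : normc (z - w) = normc (w - z).
Proof. by rewrite -normcN opprB. Qed.

Lemma cvgCP {T} {FF : set_system T} {FFF : Filter FF} (f : T -> R[i]^o)
    (l : R[i]^o) :
  f @ FF --> l <->
  forall e : R, 0 < e -> \forall x \near FF, normc (l - f x) < e.
Proof.
split=> [/cvgrPdist_lt fl e e0|fl].
  have := fl e%:C; rewrite ltcR => /(_ e0); apply: filterS => x.
  by rewrite norm_normc ltcR.
(* The norm of [R[i]^o] takes values in [R[i]], where a positive element has zero imaginary part, so
   real radii suffice. *)
apply/cvgrPdist_lt => -[e e']; rewrite ltcE /= => /andP[/eqP ->] e0.
by apply: filterS (fl e e0) => x; rewrite norm_normc ltcR.
Qed.

Lemma cvgC_normc_le {T} {FF : set_system T} {FFF : ProperFilter FF}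
    (f : T -> R[i]^o) (l : R[i]^o) (M : R) :
  f @ FF --> l -> (forall x, normc (f x) <= M) -> normc l <= M.
Proof.
move=> /cvgCP fl fM; apply/ler_addgt0Pr => e e0.
have [x /ltW lx] := @filter_ex _ FF _ _ (fl e e0).
by rewrite (le_trans (normc_le_trans l (f x)))// addrC lerD.
Qed.

End ComplexValued.

(** * Functions with candidate derivatives up to order p and uniform bounds *)

Section Jets.
Context {R : realType}.
Implicit Types (f g : cfun R) (F G : nat -> cfun R) (z w : R[i]).

(* All conditions bear on differences, so they pass to pointwise limits: no
   uniform convergence of the derivatives is ever needed. *)
Definition jet (p : nat) (C : R) F : Prop := forall x,
  [/\ forall j, (j <= p)%N -> normc (F j x) <= C,
      forall j, (j <= p)%N -> forall t : R, `|t| <= 1 ->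
        normc (F j (x + t) - F j x) <= C * `|t| &
      forall j, (j < p)%N -> forall t : R, `|t| <= 1 ->
        normc (F j (x + t) - F j x - t%:C * F j.+1 x) <= C * t ^+ 2].

Lemma jet_ge0 p C F : jet p C F -> 0 <= C.
Proof. by move=> /(_ 0)[+ _ _] => /(_ 0%N isT); exact/le_trans/normc_ge0. Qed.

Lemma jet_shift p C F h : jet p C F -> jet p C (fun j => shift_fun h (F j)).
Proof.
move=> jF x; have [j1 j2 j3] := jF (x + h); split=> j jp.
- exact: j1.
- by move=> t t1; rewrite /shift_fun [x + t + h]addrAC j2.
- by move=> t t1; rewrite /shift_fun [x + t + h]addrAC j3.
Qed.

Lemma jetB p C D F G : jet p C F -> jet p D G ->
  jet p (C + D) (fun j x => F j x - G j x).
Proof.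
move=> jF jG x; have [F1 F2 F3] := jF x; have [G1 G2 G3] := jG x.
have tri z w (a b : R) : normc z <= a -> normc w <= b -> normc (z - w) <= a + b.
  by move=> za wb; rewrite (le_trans (le_normcD _ _))// normcN lerD.
split=> j jp.
- exact: tri (F1 j jp) (G1 j jp).
- move=> t t1; rewrite mulrDl.
  suff -> : F j (x + t) - G j (x + t) - (F j x - G j x) =
    (F j (x + t) - F j x) - (G j (x + t) - G j x) :> R[i].
    exact: tri (F2 j jp t t1) (G2 j jp t t1).
  by rewrite /=; ring.
- move=> t t1; rewrite mulrDl.
  suff -> : F j (x + t) - G j (x + t) - (F j x - G j x) -
      t%:C * (F j.+1 x - G j.+1 x) =
    (F j (x + t) - F j x - t%:C * F j.+1 x) -
    (G j (x + t) - G j x - t%:C * G j.+1 x) :> R[i].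
    exact: tri (F3 j jp t t1) (G3 j jp t t1).
  by rewrite /=; ring.
Qed.

(** The filter is arbitrary so that limits along an ultrafilter are covered. *)
Lemma jet_cvg {T} {FF : set_system T} {FFF : ProperFilter FF} p C
    (H : T -> nat -> cfun R) G :
  (forall n, jet p C (H n)) ->
  (forall j x, (j <= p)%N -> (H n j x @[n --> FF] --> G j x)) ->
  jet p C G.
Proof.
move=> jH HG x; split=> j jp.
- apply: cvgC_normc_le (HG j x jp) _ => n.
  by have [+ _ _] := jH n x; exact.
- move=> t t1.
  apply: (@cvgC_normc_le _ _ FF _ (fun n => H n j (x + t) - H n j x)).
    by apply: cvgB; apply: HG.
  by move=> n; have [_ + _] := jH n x; exact.
- move=> t t1.
  apply: (@cvgC_normc_le _ _ FF _
      (fun n => H n j (x + t) - H n j x - t%:C * H n j.+1 x)).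
    apply: cvgB; first by apply: cvgB; apply: HG => //; exact: ltnW.
    by apply: cvgM; [exact: cvg_cst|apply: HG].
  by move=> n; have [_ _ +] := jH n x; exact.
Qed.

(** The difference quotient with step [t] differs from [d] by at most C|t|. *)
Lemma taylor_is_derive (f : R -> R) (x d C : R) :
  (forall t, `|t| <= 1 -> `|f (x + t) - f x - t * d| <= C * t ^+ 2) ->
  is_derive x 1 f d.
Proof.
move=> fd.
have C0 : 0 <= C.
  by have := fd 1; rewrite normr1 lexx expr1n mulr1 => /(_ isT); exact: le_trans.
have cf : h^-1 *: (f (h *: 1 + x) - f x) @[h --> 0^'] --> d.
  apply/cvgrPdist_lt => e e0; near=> h.
  have h0 : h != 0 by near: h; exact: nbhs_dnbhs_neq.
  have h1 : `|h| <= 1.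
    by near: h; apply: dnbhs0_le.
  have -> : d - h^-1 *: (f (h *: 1 + x) - f x) =
      - (h^-1 * (f (x + h) - f x - h * d)).
    by rewrite /GRing.scale/= mulr1 [h + x]addrC; field.
  rewrite normrN normrM normfV ltr_pdivrMl ?normr_gt0//.
  rewrite (le_lt_trans (fd h h1))// -real_normK ?num_real// expr2 mulrC -mulrA.
  rewrite ltr_pM2l ?normr_gt0//.
  have : `|h| < e / (C + 1).
    by near: h; apply: dnbhs0_lt; rewrite divr_gt0// ltr_wpDl.
  rewrite ltr_pdivlMr ?ltr_wpDl// => /le_lt_trans; apply.
  by rewrite ler_wpM2l// lerDl.
by apply: DeriveDef; [apply/cvg_ex; exists d|apply/cvg_lim].
Unshelve. all: by end_near. Qed.

Lemma jet_is_derive p C F j (x : R) : jet p C F -> (j < p)%N ->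
  is_derive x 1 (fun y => complex.Re (F j y)) (complex.Re (F j.+1 x)) /\
  is_derive x 1 (fun y => complex.Im (F j y)) (complex.Im (F j.+1 x)).
Proof.
move=> /(_ x)[_ _ jF] jp; split; apply: (@taylor_is_derive _ _ _ C) => t t1.
  apply: le_trans (jF j jp t t1); apply: le_trans (Re_le_normc _).
  by case: (F j _) (F j x) (F j.+1 x) => ? ? [? ?] [? ?] /=; rewrite mul0r subr0.
apply: le_trans (jF j jp t t1); apply: le_trans (Im_le_normc _).
by case: (F j _) (F j x) (F j.+1 x) => ? ? [? ?] [? ?] /=; rewrite mul0r addr0.
Qed.

(** Since pointwise limits of jets are jets, this identifies limits of derivatives with derivatives
    of the limit. *)
Lemma jet_cderiven p C F j : jet p C F -> (j <= p)%N -> cderiven j (F 0%N) = F j.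
Proof.
move=> jF; elim: j => [//|j IH] jp.
rewrite -[LHS]/(cderive (cderiven j (F 0%N))) IH; last exact: ltnW.
apply/funext => x; have [dR dI] := jet_is_derive x jF jp.
rewrite /cderive !derive1E (@derive_val _ _ _ _ _ _ _ dR).
by rewrite (@derive_val _ _ _ _ _ _ _ dI); case: (F j.+1 x).
Qed.

Lemma jet_continuous p C F j : jet p C F -> (j <= p)%N -> continuous (F j).
Proof.
move=> jF jp x; have C0 := jet_ge0 jF; apply/cvgCP => e e0.
(* The cap 1 is the range of increments that [jet] controls; [C + 1] avoids a division by zero. *)
have d0 : 0 < Num.min 1 (e / (C + 1)).
  by rewrite lt_min ltr01 divr_gt0// ltr_wpDl.
apply: filterS (nbhsx_ballx x _ d0) => y.
rewrite -ball_normE /= lt_min distrC => /andP[/ltW y1 ye].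
have [_ /(_ j jp _ y1) + _] := jF x.
rewrite [x + _]addrC subrK normcB => /le_lt_trans.
apply; move: ye; rewrite ltr_pdivlMr ?ltr_wpDl// mulrC => /le_lt_trans; apply.
by rewrite ler_wpM2r// lerDl.
Qed.

Lemma jet_unif_continuous p C F j : jet p C F -> (j <= p)%N ->
  unif_continuous (F j).
Proof.
move=> jF jp A; rewrite -entourage_ballE => -[[e e'] /=].
rewrite ltcE /= => /andP[/eqP -> e0] eA.
have C0 := jet_ge0 jF.
near_simpl; rewrite -entourage_ballE.
exists (Num.min 1 (e / (C + 1))) => /=.
  by rewrite lt_min ltr01 divr_gt0// ltr_wpDl.
move=> [x y] /=; rewrite -ball_normE /= lt_min distrC => /andP[/ltW xy1 xye].
apply: eA; rewrite -ball_normE /= norm_normc ltcR normcB.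
have [_ /(_ j jp _ xy1) + _] := jF x; rewrite [x + _]addrC subrK => /le_lt_trans.
apply; move: xye; rewrite ltr_pdivlMr ?ltr_wpDl// mulrC => /le_lt_trans; apply.
by rewrite ler_wpM2r// lerDl.
Qed.

(** Makes the hypothesis on the homogeneous equation applicable to z - u. *)
Lemma jet_class_C_ub p C F : jet p C F -> class_C_ub p (F 0%N).
Proof.
move=> jF; split; first split.
- move=> j jp x; rewrite (jet_cderiven jF (ltnW jp)).
  by have [? ?] := jet_is_derive x jF jp; split; exact: ex_derive.
- by rewrite (jet_cderiven jF (leqnn p)); exact: jet_continuous jF _.
move=> j jp; rewrite (jet_cderiven jF jp); split.
  exact: jet_unif_continuous jF _.
(* Bounds for [bounded_fun] live in [R[i]], so the witness is [C] embedded there, and any larger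
   bound is real too. *)
exists C%:C; split; first by apply/complex_realP; exists C.
move=> [M M']; rewrite ltcE /= => /andP[/eqP -> CM] x _ /=.
rewrite norm_normc lecR (le_trans _ (ltW CM))//.
by have [+ _ _] := jF x; exact.
Qed.

Lemma jet_L_fun p q C F (a : 'I_p.+1 -> 'I_q.+1 -> R[i]) (h : 'I_q.+1 -> R) x :
  jet p C F ->
  L_fun a h (F 0%N) x = \sum_(i < p.+1) \sum_(j < q.+1) a i j * F i (x + h j).
Proof.
move=> jF; apply: eq_bigr => i _; apply: eq_bigr => j _; congr (_ * _).
by rewrite (jet_cderiven (jet_shift (h j) jF)) // -ltnS.
Qed.

End Jets.

(** * Extraction of pointwise convergent subsequences of translates *)

Section Subsequences.
Context {R : realType}.

(** Compactness gives a cluster point, and an ultrafilter converges to its cluster points. *)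
Lemma bounded_ultra_cvg {T} {U : set_system T} {UU : UltraFilter U} (f : T -> R)
    (C : R) :
  (forall x, `|f x| <= C) -> exists l : R, f @ U --> l.
Proof.
move=> fC; have [l _ lcl] : exists2 l, `[- C, C]%classic l & cluster (f @ U) l.
  have [|l [? ?]] := @segment_compact R (- C) C (f @ U) _.
    apply: (@filterE _ U _ (f @^-1` `[- C, C])) => x /=.
    by rewrite in_itv/= -ler_norml.
  by exists l.
exists l => A lA; have [//|UnA] := @in_ultra_setVsetC _ U (f @^-1` A) UU.
by have [x [? ?]] := lcl (~` A) A UnA lA.
Qed.

Lemma bounded_ultra_cvgC {T} {U : set_system T} {UU : UltraFilter U}
    (f : T -> R[i]^o) (C : R) :
  (forall x, normc (f x) <= C) -> exists l : R[i]^o, f @ U --> l.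
Proof.
move=> fC.
have [a /cvgrPdist_lt fa] := @bounded_ultra_cvg _ U UU (fun x => complex.Re (f x)) C
  (fun x => le_trans (Re_le_normc _) (fC x)).
have [b /cvgrPdist_lt fb] := @bounded_ultra_cvg _ U UU (fun x => complex.Im (f x)) C
  (fun x => le_trans (Im_le_normc _) (fC x)).
exists (a +i* b); apply/cvgCP => e e0; have e20 : 0 < e / 2 by rewrite divr_gt0.
apply: filterS2 (fa _ e20) (fb _ e20) => x xa xb.
rewrite (le_lt_trans (normc_le_ReIm _))// [ltRHS]splitr.
by move: xa xb; case: (f x) => c d /=; exact: ltrD.
Qed.

Lemma ltn_homo_cvg (k : nat -> nat) : {homo k : m n / (m < n)%N} -> k @ \oo --> \oo.
Proof.
move=> hk; apply/cvgnyPge => N; exists N => // n /= Nn.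
rewrite (leq_trans Nn)//; elim: n {Nn} => // n IH.
exact: leq_ltn_trans IH (hk _ _ _).
Qed.

(** Diagonal extraction: the n-th index is chosen beyond the previous one and has to meet the n-th
    requirement only. *)
Lemma frequently_subseq (P : nat -> nat -> Prop) :
  (forall n N, exists2 m, (N < m)%N & P n m) ->
  exists2 k : nat -> nat, {homo k : m n / (m < n)%N} & forall n, P n (k n).
Proof.
move=> HP.
have {HP} /choice[m Hm] : forall nN : nat * nat, exists m, (nN.2 < m)%N /\ P nN.1 m.
  by move=> [n N]; have [m ? ?] := HP n N; exists m.
pose fix k n := if n is n'.+1 then m (n, k n') else m (0%N, 0%N).
exists k; last by case=> [|n]; [have [] := Hm (0, 0)%N|have [] := Hm (n.+1, k n)].
by apply: homo_ltn => [|n]; [exact: ltn_trans|have [] := Hm (n.+1, k n)].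
Qed.

(* The limit is first taken along an ultrafilter; a subsequence converging to it
   at all rationals converges everywhere, by the uniform Lipschitz bound. *)
Lemma jet_subseq p C (F : nat -> cfun R) (s : nat -> R) : jet p C F ->
  exists2 k : nat -> nat, {homo k : m n / (m < n)%N} &
  exists2 G : nat -> cfun R, jet p C G &
    forall j x, (j <= p)%N -> F j (x + s (k n)) @[n --> \oo] --> G j x.
Proof.
move=> jF; have C0 := jet_ge0 jF.
have [U [UU ooU]] := @ultraFilterLemma nat \oo _.
(* Choice needs a value at every pair; orders above [p], where no bound is available, get 0. *)
have /choice[G0 HG0] : forall jx : nat * R, exists l : R[i]^o, (jx.1 <= p)%N ->
    (F jx.1 (jx.2 + s m) @[m --> U] --> l).
  move=> [j x] /=; have [jp|] := boolP (j <= p)%N; last by exists 0.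
  have [l] := @bounded_ultra_cvgC _ U UU (fun m => F j (x + s m)) C
    (fun m => let: And3 F1 _ _ := jF (x + s m) in F1 j jp).
  by exists l.
pose G j x := G0 (j, x).
have HG j x : (j <= p)%N -> (F j (x + s m) @[m --> U] --> G j x).
  exact: HG0 (j, x).
have jG : jet p C G.
  apply: (@jet_cvg _ _ U _ p C (fun m j => shift_fun (s m) (F j))) => [m|].
    exact: jet_shift.
  exact: HG.
(* [r] enumerates the rationals, with 0 for codes that decode to nothing. [P n m] asks for error
   below 1/(n+1) at the first n+1 of them, for all orders up to [p]. *)
pose r i : R := ratr (odflt 0 (unpickle i)).
pose P n m := forall j : 'I_p.+1, forall i : 'I_n.+1,
  normc (G j (r i) - F j (r i + s m)) < n.+1%:R^-1.
have [n N|k hk Pk] := @frequently_subseq P.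
  (* [U] contains the tails of the integers and each of the finitely many conditions in [P n], hence
     their intersection, which is nonempty. *)
  suff /filter_ex[m [? ?]] : U [set m | (N < m)%N /\ P n m] by exists m.
  apply: filterI; first by apply: ooU; exists N.+1.
  apply: filter_forall => j; apply: filter_forall => i.
  by have /cvgCP := HG _ (r i) (ltn_ord j : (j <= p)%N); apply; rewrite invr_gt0.
exists k => //; exists G => // j x jp; apply/cvgCP => e e0.
have d0 : 0 < Num.min 1 (e / 3 / (C + 1)).
  by rewrite lt_min ltr01 !divr_gt0// ltr_wpDl.
have [q] := @rat_in_itvoo R x _ (ltr_pwDr d0 (lexx x)).
rewrite in_itv /= -ltrBlDl => /andP[xq]; rewrite lt_min => /andP[q1 qe].
set t := ratr q - x in q1 qe.
have t0 : 0 <= t by rewrite subr_ge0 ltW.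
have t1 : `|t| <= 1 by rewrite ger0_norm// ltW.
have Ct : C * `|t| < e / 3.
  rewrite ger0_norm//; move: qe; rewrite ltr_pdivlMr ?ltr_wpDl//.
  by apply: le_lt_trans; rewrite mulrC ler_wpM2l// lerDl.
have xt y : y + x + t = y + ratr q by rewrite /t -addrA [x + _]addrC subrK.
have rq : r (pickle q) = ratr q by rewrite /r pickleK.
near=> n.
have qn : (pickle q < n.+1)%N by rewrite ltnS; near: n; exact: nbhs_infty_ge.
have := Pk n (Ordinal (jp : (j < p.+1)%N)) (Ordinal qn).
rewrite -[r _]/(r (pickle q)) rq => Pn.
have {}Pn : normc (G j (x + t) - F j (x + s (k n) + t)) < e / 3.
  have -> : x + t = ratr q by rewrite /t [x + _]addrC subrK.
  rewrite [x + _]addrC xt [s _ + _]addrC (lt_trans Pn)//.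
  by near: n; apply: near_infty_natSinv_lt (PosNum _); rewrite divr_gt0.
have [_ /(_ j jp t t1) Gt _] := jG x.
have [_ /(_ j jp t t1) Ft _] := jF (x + s (k n)).
(* Three errors of size e/3: the approximation at the rational x + t, and the oscillations of [G j]
   and of [F j] over a step [t]. *)
have -> : G j x - F j (x + s (k n)) =
  (G j (x + t) - F j (x + s (k n) + t)) - (G j (x + t) - G j x) +
  (F j (x + s (k n) + t) - F j (x + s (k n))) :> R[i] by rewrite /=; ring.
apply: le_lt_trans (le_normcD _ _) _.
apply: le_lt_trans (lerD (le_normcD _ _) (lexx _)) _; rewrite normcN.
by move: Pn Gt Ft Ct; lra.
Unshelve. all: by end_near. Qed.

End Subsequences.

(** * The operator on jets and the double limit argument *)

Section DoubleLimit.
Context {R : realType}.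

Lemma cvgC_unique (u : nat -> R[i]^o) (l l' : R[i]^o) :
  u @ \oo --> l -> u @ \oo --> l' -> l = l'.
Proof.
move=> ul ul'; rewrite -(cvg_lim _ ul) ?(cvg_lim _ ul')//; exact: norm_hausdorff.
Qed.

Lemma cvgC_comb_le (u w : nat -> R[i]^o) (l l' : R[i]^o) (c : R[i]) (M : R) :
  u @ \oo --> l -> w @ \oo --> l' -> (forall n, normc (u n + c * w n) <= M) ->
  normc (l + c * l') <= M.
Proof.
move=> ul wl'; apply: (@cvgC_normc_le _ _ \oo _ (fun n => u n + c * w n)).
by apply: cvgD ul _; apply: cvgM; [exact: cvg_cst|exact: wl'].
Qed.

Variables (p q : nat) (a : 'I_p.+1 -> 'I_q.+1 -> R[i]) (h : 'I_q.+1 -> R).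

(** L_h with [F i] in place of the i-th derivative: a finite combination of values, so it commutes
    with pointwise limits. *)
Definition jet_op (F : nat -> cfun R) : cfun R := fun x =>
  \sum_(i < p.+1) \sum_(j < q.+1) a i j * F i (x + h j).

Lemma jet_op_cvg (F G : nat -> cfun R) (s : nat -> R) :
  (forall j x, (j <= p)%N -> F j (x + s n) @[n --> \oo] --> G j x) ->
  forall x, jet_op F (x + s n) @[n --> \oo] --> jet_op G x.
Proof.
move=> FG x; rewrite /jet_op.
apply: cvg_big => [|i _]; first exact: add_continuous.
apply: cvg_big => [|j _]; first exact: add_continuous.
apply: cvgM; first exact: cvg_cst.
rewrite [X in X @ _ --> _](_ : _ = fun n => F i (x + h j + s n)); last first.
  by apply/funext => n; rewrite addrAC.
by apply: FG; rewrite -ltnS.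
Qed.

(** The part of the argument free of distributions: [F 0] stands for u and [jet_op F] for v. *)
Lemma almost_automorphic_jet C (F : nat -> cfun R) :
  (forall f : cfun R, class_C_ub p f -> (forall x, L_fun a h f x = 0) ->
     almost_automorphic f) ->
  jet p C F -> almost_automorphic (jet_op F) -> almost_automorphic (F 0%N).
Proof.
move=> homog jF [_ aav]; split=> [|s]; first exact: jet_continuous jF _.
have [k1 [hk1 [g gv]]] := aav s.
have [k2 hk2 [G jG FG]] := jet_subseq (s \o k1) jF.
have [k3 hk3 [Z jZ GZ]] := jet_subseq (fun n => - s (k1 (k2 n))) jG.
have sub k (u : nat -> R[i]^o) (l : R[i]^o) : {homo k : m n / (m < n)%N} ->
    u @ \oo --> l -> u (k n) @[n --> \oo] --> l.
  by move=> /ltn_homo_cvg hk; exact: cvg_comp hk.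
have {FG} FG j x : (j <= p)%N -> F j (x + s (k1 (k2 n))) @[n --> \oo] --> G j x.
  by move=> jp; exact: FG.
(* Both are limits of v along the same shifts; [vZ] repeats this backwards, where almost automorphy
   returns g to v. *)
have vg x : jet_op G x = g x.
  apply: (@cvgC_unique (fun n => jet_op F (x + s (k1 (k2 n))))).
    exact: jet_op_cvg.
  exact: (sub k2 (fun n => jet_op F (x + s (k1 n))) _ hk2 (gv x).1).
have vZ x : jet_op Z x = jet_op F x.
  apply: (@cvgC_unique (fun n => jet_op G (x - s (k1 (k2 (k3 n)))))).
    exact: jet_op_cvg.
  under eq_cvg do rewrite vg.
  apply: (sub (k2 \o k3) (fun n => g (x - s (k1 n))) _ _ (gv x).2).
  by move=> m n mn; exact/hk2/hk3.
(* [G 0] and [Z 0] are the limits w and z, and [P 0] is z - u; the [r] obtained below is the limit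
   of [P 0] along the refined shifts. *)
pose P j x : R[i]^o := Z j x - F j x.
have jP : jet p (C + C) P := jetB jZ jF.
have {homog} [_ /(_ (s \o k1 \o k2 \o k3))] : almost_automorphic (P 0%N).
  apply: homog; first exact: jet_class_C_ub jP.
  move=> x; rewrite (jet_L_fun a h x jP).
  transitivity (jet_op Z x - jet_op F x); last by rewrite vZ subrr.
  rewrite /jet_op -sumrB; apply: eq_bigr => i _.
  by rewrite -sumrB; apply: eq_bigr => j _; rewrite -mulrBr.
move=> [k4 [hk4 [r Pr]]].
have Fs x : F 0%N (x + s (k1 (k2 (k3 (k4 n))))) @[n --> \oo] --> G 0%N x.
  apply: (sub (k3 \o k4) (fun n => F 0%N (x + s (k1 (k2 n)))) _ _ (FG 0%N x isT)).
  by move=> m n mn; exact/hk3/hk4.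
have Gs x : G 0%N (x - s (k1 (k2 (k3 (k4 n))))) @[n --> \oo] --> Z 0%N x.
  exact: (sub k4 (fun n => G 0%N (x - s (k1 (k2 (k3 n))))) _ hk4 (GZ 0%N x isT)).
(* Passing to the double limit along s adds P to F + m P, but keeps its bound. *)
have FP m x : normc (F 0%N x + m%:R * P 0%N x) <= C.
  elim: m x => [x|m IH x].
    by rewrite mul0r addr0; have [+ _ _] := jF x; exact.
  have Gr y : normc (G 0%N y + m%:R * r y) <= C.
    apply: cvgC_comb_le (Fs y) (Pr y).1 _ => n.
    exact: IH.
  have -> : F 0%N x + m.+1%:R * P 0%N x = Z 0%N x + m%:R * P 0%N x :> R[i].
    by rewrite /P /= -natr1; ring.
  apply: cvgC_comb_le (Gs x) (Pr x).2 _ => n.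
  exact: Gr.
have P0 x : P 0%N x = 0.
  apply/eq0_normc/eqP; rewrite eq_le normc_ge0 andbT leNgt; apply/negP => y0.
  (* Some integer m exceeds 2C / |P 0 x|, whereas m |P 0 x| is at most |F 0 x + m P 0 x| + |F 0 x|,
     hence at most 2C. *)
  have := archi_boundP (divr_ge0 (jet_ge0 jP) (ltW y0)).
  set m := Num.bound _; rewrite ltr_pdivrMr// => /lt_geF/negP; apply.
  have -> : m%:R * normc (P 0%N x) = normc (m%:R * P 0%N x).
    by rewrite normcM -(rmorph_nat (real_complex R)) normc_real ger0_norm.
  rewrite (le_trans (normc_le_trans _ (- F 0%N x)))// opprK normcN.
  by rewrite [X in normc X + _]addrC lerD//; have [+ _ _] := jF x; exact.
exists (k1 \o k2 \o k3 \o k4); split.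
  by move=> m n mn; exact/hk1/hk2/hk3/hk4.
exists (G 0%N) => x; split; first exact: Fs.
have -> : F 0%N x = Z 0%N x by apply/esym/eqP; rewrite -subr_eq0; apply/eqP/P0.
exact: Gs.
Qed.
End DoubleLimit.

(** * Smooth functions given with all their derivatives *)

Section Towers.
Context {R : realType}.
Implicit Types (f g : cfun R) (F G : nat -> cfun R) (x : R).

Definition is_cderive f x (d : R[i]) : Prop :=
  is_derive x 1 (fun y => complex.Re (f y)) (complex.Re d) /\
  is_derive x 1 (fun y => complex.Im (f y)) (complex.Im d).

(** Carrying the whole sequence of derivatives makes those of translates, reflections and
    combinations explicit, with no computation of iterated derivatives. *)
Definition tower F : Prop := forall j x, is_cderive (F j) x (F j.+1 x).

Lemma cderivableP f x : cderivable f x -> is_cderive f x (cderive f x).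
Proof.
move=> [/derivableP fR /derivableP fI]; rewrite -!derive1E in fR fI.
by split; [exact: fR|exact: fI].
Qed.

Lemma is_cderiveP f x d : is_cderive f x d -> cderivable f x /\ cderive f x = d.
Proof.
move=> [fR fI]; split; first by split; exact: ex_derive.
rewrite /cderive !derive1E (@derive_val _ _ _ _ _ _ _ fR).
by rewrite (@derive_val _ _ _ _ _ _ _ fI); case: d {fR fI}.
Qed.

Lemma is_cderive_continuous f x d : is_cderive f x d -> {for x, continuous f}.
Proof.
move=> [fR fI].
have /differentiable_continuous/cvgrPdist_lt cR :=
  (derivable1_diffP _ _).1 (@ex_derive _ _ _ _ _ _ _ fR).
have /differentiable_continuous/cvgrPdist_lt cI :=
  (derivable1_diffP _ _).1 (@ex_derive _ _ _ _ _ _ _ fI).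
apply/cvgCP => e e0; have e20 : 0 < e / 2 by rewrite divr_gt0.
apply: filterS2 (cR _ e20) (cI _ e20) => y.
move=> yR yI; apply: le_lt_trans (normc_le_ReIm _) _.
move: yR yI => /=; case: (f x) (f y) => ? ? [? ?] /=; lra.
Qed.

Lemma tower_cderiven F j : tower F -> cderiven j (F 0%N) = F j.
Proof.
move=> tF; elim: j => [//|j IH].
rewrite -[LHS]/(cderive (cderiven j (F 0%N))) IH.
by apply/funext => x; have [_] := is_cderiveP (tF j x).
Qed.

Lemma tower_smooth F : tower F -> smooth (F 0%N).
Proof.
move=> tF p; split=> [j _ x|x]; rewrite tower_cderiven//.
  by have [] := is_cderiveP (tF j x).
exact: is_cderive_continuous (tF p x).
Qed.

Lemma smooth_tower f : smooth f -> tower (fun j => cderiven j f).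
Proof. by move=> sf j x; apply: cderivableP; have [+ _] := sf j.+1; exact. Qed.

Lemma tower_continuous F j : tower F -> continuous (F j).
Proof. by move=> tF x; exact: is_cderive_continuous (tF j x). Qed.

Lemma tower_drop F n : tower F -> tower (fun j => F (j + n)%N).
Proof. by move=> tF j; exact: tF. Qed.

Lemma tower0 : tower (fun _ _ => 0).
Proof. by move=> j x; split; exact: is_derive_cst. Qed.

Lemma tower_lin (c : R[i]) F G : tower F -> tower G ->
  tower (fun j x => c * F j x + G j x).
Proof.
move=> tF tG j x; have [FR FI] := tF j x; have [GR GI] := tG j x.
case: c => a b; split.
- rewrite (_ : (fun y => _) = (fun y => a * complex.Re (F j y) -
      b * complex.Im (F j y) + complex.Re (G j y))); last first.
    by apply/funext => y; case: (F j y) (G j y) => ? ? [].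
  rewrite (_ : complex.Re _ = a * complex.Re (F j.+1 x) -
      b * complex.Im (F j.+1 x) + complex.Re (G j.+1 x)); last first.
    by case: (F j.+1 x) (G j.+1 x) => ? ? [].
  apply: is_deriveD; apply: is_deriveB; exact: is_deriveZ.
- rewrite (_ : (fun y => _) = (fun y => a * complex.Im (F j y) +
      b * complex.Re (F j y) + complex.Im (G j y))); last first.
    by apply/funext => y; case: (F j y) (G j y) => ? ? [].
  rewrite (_ : complex.Im _ = a * complex.Im (F j.+1 x) +
      b * complex.Re (F j.+1 x) + complex.Im (G j.+1 x)); last first.
    by case: (F j.+1 x) (G j.+1 x) => ? ? [].
  apply: is_deriveD; apply: is_deriveD; exact: is_deriveZ.
Qed.

Lemma tower_shift F t : tower F -> tower (fun j => shift_fun t (F j)).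
Proof.
move=> tF j x; have [FR FI] := tF j (x + t).
have dt : is_derive x 1 (fun y => y + t) (1 : R).
  by rewrite -[1 in X in is_derive _ _ _ X]addr0; exact: is_deriveD.
split.
  have := @is_derive1_comp _ (fun y => complex.Re (F j y)) (fun y => y + t)
    _ _ _ FR dt.
  by rewrite mulr1.
have := @is_derive1_comp _ (fun y => complex.Im (F j y)) (fun y => y + t)
    _ _ _ FI dt.
by rewrite mulr1.
Qed.

(** The successive derivatives of y -> F 0 (c - y), with the sign of the chain rule; convolution
    evaluates T on such functions. *)
Definition reflect_tower (c : R) F : nat -> cfun R :=
  fun j y => (-1) ^+ j * F j (c - y).

Lemma tower_reflect F (c : R) : tower F -> tower (reflect_tower c F).
Proof.
rewrite /reflect_tower => tF j x; have [FR FI] := tF j (c - x).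
have dc : is_derive x 1 (fun y => c - y) (-1 : R).
  by rewrite -[X in is_derive _ _ _ X]add0r; exact: is_deriveB.
(* The sign is a complex power on the left and a real one on the right, so it acts on each component
   as a real scalar. *)
have sgn (k : nat) (z : R[i]) :
    (-1) ^+ k * z = ((-1) ^+ k * complex.Re z) +i* ((-1) ^+ k * complex.Im z).
  elim: k => [|k IH]; first by rewrite !expr0 !mul1r; case: z.
  by rewrite !exprSr -!mulrA !mulN1r !mulrN IH.
split.
  rewrite (_ : (fun y => _) = (fun y => (-1) ^+ j * complex.Re (F j (c - y)))).
    rewrite sgn /= exprSr -mulrA mulN1r -[- complex.Re _]mulrN1.
    apply: is_deriveZ.
    exact: (@is_derive1_comp _ (fun y => complex.Re (F j y)) (fun y => c - y)
      _ _ _ FR dc).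
  by apply/funext => y; rewrite sgn.
rewrite (_ : (fun y => _) = (fun y => (-1) ^+ j * complex.Im (F j (c - y)))).
  rewrite sgn /= exprSr -mulrA mulN1r -[- complex.Im _]mulrN1.
  apply: is_deriveZ.
  exact: (@is_derive1_comp _ (fun y => complex.Im (F j y)) (fun y => c - y)
    _ _ _ FI dc).
by apply/funext => y; rewrite sgn.
Qed.

Lemma derive_bound (f df : R -> R) (B : R) :
  (forall x, is_derive x 1 f (df x)) -> (forall x, `|df x| <= B) ->
  forall x t, `|f (x + t) - f x| <= B * `|t|.
Proof.
move=> fdf dfB.
have H a b : a <= b -> `|f b - f a| <= B * `|b - a|.
  move=> ab; have [|c _ ->] := @MVT_segment R f df a b ab (fun x _ => fdf x).
    apply: derivable_within_continuous => x _; exact: (@ex_derive _ _ _ _ _ _ _ (fdf x)).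
  by rewrite normrM ler_wpM2r.
move=> x t; have [t0|t0] := leP 0 t.
  by have := H x (x + t); rewrite lerDl addrAC subrr add0r; exact.
have := H (x + t) x; rewrite gerDl ltW// distrC opprD addrA subrr add0r normrN.
exact.
Qed.

(** The mean value theorem is used twice: f(b) - f(a) = (b - a) f'(c), and then f'(c) - f'(x) is at
    most B|c - x|. *)
Lemma taylor_bound (f df ddf : R -> R) (B : R) :
  (forall x, is_derive x 1 f (df x)) -> (forall x, is_derive x 1 df (ddf x)) ->
  (forall x, `|ddf x| <= B) ->
  forall x t, `|f (x + t) - f x - t * df x| <= B * t ^+ 2.
Proof.
move=> fdf dfddf ddfB x.
(* The base point [x] may be either endpoint, which serves both signs of [t]. *)
have H a b : a <= b -> x \in `[a, b] ->
    `|f b - f a - (b - a) * df x| <= B * (b - a) ^+ 2.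
  move=> ab; rewrite in_itv /= => /andP[ax xb].
  have [|c] := @MVT_segment R f df a b ab (fun x _ => fdf x).
    apply: derivable_within_continuous => y _.
    exact: (@ex_derive _ _ _ _ _ _ _ (fdf y)).
  rewrite in_itv /= => /andP[ac cb] ->.
  rewrite mulrC -mulrBr normrM expr2 mulrCA.
  rewrite [X in X * _ <= _]ger0_norm ?subr_ge0// ler_wpM2l ?subr_ge0//.
  have := derive_bound dfddf ddfB x (c - x); rewrite [x + _]addrC subrK => /le_trans; apply.
  rewrite ler_wpM2l ?(le_trans _ (ddfB 0))//.
  by rewrite ler_norml; apply/andP; split; lra.
move=> t; have [t0|t0] := leP 0 t.
  have := H x (x + t); rewrite lerDl in_itv /= lexx lerDl t0 [x + t - x]addrAC subrr add0r.
  exact.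
have := H (x + t) x; rewrite gerDl in_itv /= lexx gerDl ltW//.
rewrite (_ : x - (x + t) = - t); last by rewrite opprD addrA subrr add0r.
rewrite sqrrN -normrN (_ : - (_ - _ - _) = f (x + t) - f x - t * df x); last ring.
exact.
Qed.

End Towers.

(** * Sup bounds and D_L1 norms for compactly supported functions *)

Section CompactSupport.
Context {R : realType}.
Implicit Types (f : cfun R) (F : nat -> cfun R).

Lemma normcB_le (z w : R[i]) : `|normc z - normc w| <= normc (z - w).
Proof.
have := normc_le_trans z w; have := normc_le_trans w z; rewrite normcB => h1 h2.
by rewrite ler_norml; apply/andP; split; lra.
Qed.

Lemma continuous_comp_normc f (g : R[i] -> R) :
  (forall z w, `|g z - g w| <= normc (z - w)) ->
  continuous f -> continuous (fun x => g (f x) : R).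
Proof.
move=> glip cf x; apply/cvgrPdist_lt => e e0.
have /cvgCP /(_ e e0) := cf x; apply: filterS => y.
exact: le_lt_trans (glip _ _).
Qed.

Lemma Re_lip (z w : R[i]) : `|complex.Re z - complex.Re w| <= normc (z - w).
Proof. by apply: le_trans (Re_le_normc _); case: z w => ? ? []. Qed.

Lemma Im_lip (z w : R[i]) : `|complex.Im z - complex.Im w| <= normc (z - w).
Proof. by apply: le_trans (Im_le_normc _); case: z w => ? ? []. Qed.

Lemma restrict_vanish (g : R -> R) (u v : R) :
  (forall x, x \notin `[u, v] -> g x = 0) -> g \_ `[u, v] = g.
Proof.
move=> g0; apply/funext => x; rewrite patchE mem_setE; case: ifPn => // xuv.
by rewrite g0.
Qed.

Lemma integrable_compact_support (g : R -> R) (u v : R) : continuous g ->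
  (forall x, x \notin `[u, v] -> g x = 0) ->
  lebesgue_measure.-integrable [set: R] (EFin \o g).
Proof.
move=> cg g0; rewrite -(restrict_vanish g0) -restrict_EFin -integrable_mkcond//.
apply: continuous_compact_integrable; first exact: segment_compact.
exact: continuous_subspaceT.
Qed.

Lemma Rintegral_compact_support_le (g : R -> R) (u v B : R) : u < v ->
  continuous g -> (forall x, x \notin `[u, v] -> g x = 0) ->
  (forall x, g x <= B) ->
  \int[lebesgue_measure]_(x in [set: R]) g x <= B * (v - u).
Proof.
move=> uv cg g0 gB; rewrite -(restrict_vanish g0) -Rintegral_mkcond.
have -> : B * (v - u) = \int[lebesgue_measure]_(_ in `[u, v]) B.
  transitivity (B * fine (lebesgue_measure (`[u, v]%classic : set R))).
    by rewrite lebesgue_measure_itv /= lte_fin uv.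
  by apply/esym/Rintegral_cst; exact: measurable_itv.
apply: le_Rintegral => //; apply: continuous_compact_integrable.
- exact: segment_compact.
- exact: continuous_subspaceT.
- exact: segment_compact.
- by apply: continuous_subspaceT => x; exact: cvg_cst.
Qed.

Lemma integrable_L1_compact_support f (u v : R) : continuous f ->
  (forall x, x \notin `[u, v] -> f x = 0) -> integrable_L1 f.
Proof.
move=> cf f0; split.
  apply: (@integrable_compact_support (fun x => complex.Re (f x)) u v).
    exact: continuous_comp_normc Re_lip cf.
  by move=> x /f0 ->.
apply: (@integrable_compact_support (fun x => complex.Im (f x)) u v).
  exact: continuous_comp_normc Im_lip cf.
by move=> x /f0 ->.
Qed.

Lemma norm_L1_le f (u v B : R) : u < v -> continuous f ->
  (forall x, x \notin `[u, v] -> f x = 0) -> (forall x, normc (f x) <= B) ->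
  norm_L1 f <= B * (v - u).
Proof.
move=> uv cf f0 fB; apply: Rintegral_compact_support_le => //.
  exact: continuous_comp_normc normcB_le cf.
by move=> x /f0 ->; rewrite normc0.
Qed.

(** An explicit segment is kept instead of a compact support because its length enters the L1
    estimates. *)
Definition vanish_outside (u v : R) f := forall x, x \notin `[u, v] -> f x = 0.


(** The complement of a segment is open, so a function vanishing there is locally zero at each of
    its points, and so is its derivative. *)
Lemma tower_vanish F u v : tower F -> vanish_outside u v (F 0%N) ->
  forall j, vanish_outside u v (F j).
Proof.
move=> tF F0; elim=> [//|j IH] x xuv.
have near0 : \forall y \near x, F j y = 0.
  have : open (~` `[u, v]%classic) by apply: closed_openC; exact: interval_closed.
  move=> /(_ x) H; apply: filterS (H _) => [y /= /negP yuv|]; first exact: IH.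
  exact/negP.
have [_ <-] := is_cderiveP (tF j x).
rewrite /cderive !derive1E.
rewrite (@near_eq_derive _ _ _ _ (cst 0)).
  rewrite (@near_eq_derive _ _ _ (fun y => complex.Im (F j y)) (cst 0)).
    by rewrite !derive_cst.
  by apply: filterS near0 => y ->.
by apply: filterS near0 => y ->.
Qed.

Lemma tower_D_L1 F u v : tower F -> vanish_outside u v (F 0%N) -> D_L1 (F 0%N).
Proof.
move=> tF F0; split; first exact: tower_smooth.
move=> j; rewrite tower_cderiven//.
apply: (@integrable_L1_compact_support _ u v).
  exact: tower_continuous.
exact: (tower_vanish tF F0).
Qed.

Lemma tower_norm_D_L1_le F u v m B : tower F -> u < v ->
  vanish_outside u v (F 0%N) ->
  (forall j x, (j <= m)%N -> normc (F j x) <= B) ->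
  norm_D_L1 m (F 0%N) <= m.+1%:R * (B * (v - u)).
Proof.
move=> tF uv F0 FB; rewrite /norm_D_L1.
apply: (@le_trans _ _ (\sum_(i < m.+1) B * (v - u))).
  apply: ler_sum => j _; rewrite tower_cderiven//; apply: norm_L1_le => //.
  - exact: tower_continuous.
  - exact: (tower_vanish tF F0).
  - by move=> x; apply: FB; rewrite -ltnS.
by rewrite sumr_const card_ord mulr_natl.
Qed.

Lemma tower_bounded F u v m : tower F -> u <= v -> vanish_outside u v (F 0%N) ->
  exists2 B : R, 0 < B & forall j x, (j <= m)%N -> normc (F j x) <= B.
Proof.
move=> tF uv F0.
have one j : exists2 B : R, 0 < B & forall x, normc (F j x) <= B.
  have cn : continuous (fun x => normc (F j x)).
    by apply: (continuous_comp_normc normcB_le); exact: tower_continuous.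
  have [c _ cmax] := EVT_max uv (continuous_subspaceT cn).
  exists (normc (F j c) + 1); first by rewrite ltr_wpDl// normc_ge0.
  move=> x; have [/cmax|xuv] := boolP (x \in `[u, v]).
    by move=> /le_trans; apply; rewrite lerDl.
  by rewrite (tower_vanish tF F0 j xuv) normc0 addr_ge0// normc_ge0.
elim: m => [|m [B B0 FB]].
  have [B B0 FB] := one 0%N.
  by exists B => // j x; rewrite leqn0 => /eqP ->.
have [B' B'0 FB'] := one m.+1; exists (B + B'); first by rewrite addr_gt0.
move=> j x; rewrite leq_eqVlt => /predU1P[->|/FB jB].
  by rewrite (le_trans (FB' x))// lerDr ltW.
by rewrite (le_trans (jB x))// lerDl ltW.
Qed.

Lemma test_fun_vanish f : test_fun f ->
  exists2 K : R, 0 < K & vanish_outside (- K) K f.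
Proof.
move=> [_ /compact_bounded[M [_ /(_ (`|M| + 1))]]].
rewrite (le_lt_trans (ler_norm M)) ?ltrDl// => /(_ isT) HM.
exists (`|M| + 1); first by rewrite ltr_wpDl.
move=> x; rewrite in_itv/= -ler_norml => xM; apply/eqP; apply: contraNT xM => fx.
by apply: HM; exact: subset_closure.
Qed.

Lemma vanish_test_fun f u v : smooth f -> vanish_outside u v f -> test_fun f.
Proof.
move=> sf f0; split=> //.
apply: (@subclosed_compact _ _ `[u, v]%classic); first exact: closed_closure.
  exact: segment_compact.
have cl : closed `[u, v]%classic by exact: interval_closed.
rewrite [X in _ `<=` X]((closure_id _).1 cl).
apply: closure_subset => x /= fx; apply: contraNT fx => /f0 ->; exact: eqxx.
Qed.

(** The mean value theorem applies to real and imaginary parts separately, whence the factor 2, here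
    and in [tower_taylor]. *)
Lemma tower_lipschitz F j B : tower F -> (forall x, normc (F j.+1 x) <= B) ->
  forall (x t : R), normc (F j (x + t) - F j x) <= 2 * B * `|t|.
Proof.
move=> tF FB x t; apply: le_trans (normc_le_ReIm _) _.
have := derive_bound (fun y => (tF j y).1)
  (fun y => le_trans (Re_le_normc _) (FB y)) x t.
have := derive_bound (fun y => (tF j y).2)
  (fun y => le_trans (Im_le_normc _) (FB y)) x t.
by case: (F j (x + t)) (F j x) => ? ? [? ?] /=; lra.
Qed.

Lemma tower_taylor F j B : tower F -> (forall x, normc (F j.+2 x) <= B) ->
  forall (x t : R), normc (F j (x + t) - F j x - t%:C * F j.+1 x) <= 2 * B * t ^+ 2.
Proof.
move=> tF FB x t; apply: le_trans (normc_le_ReIm _) _.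
have := taylor_bound (fun y => (tF j y).1) (fun y => (tF j.+1 y).1)
  (fun y => le_trans (Re_le_normc _) (FB y)) x t.
have := taylor_bound (fun y => (tF j y).2) (fun y => (tF j.+1 y).2)
  (fun y => le_trans (Im_le_normc _) (FB y)) x t.
case: (F j (x + t)) (F j x) (F j.+1 x) => ? ? [? ?] [? ?] /=.
by rewrite !mul0r subr0 addr0; lra.
Qed.

End CompactSupport.

Local Notation conv := Defs.conv.

(** * Regularization of bounded distributions by test functions *)

Section Convolution.
Context {R : realType}.
Implicit Types (T : functional R) (F : nat -> cfun R) (f phi : cfun R).

Lemma reflect_tower0 c F : reflect_tower c F 0%N = fun y => F 0%N (c - y).
Proof. by apply/funext => y; rewrite /reflect_tower expr0 mul1r. Qed.

Lemma normc_reflect_tower c F j y :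
  normc (reflect_tower c F j y) = normc (F j (c - y)).
Proof.
rewrite /reflect_tower; elim: j (F j _) => [|j IH] z; first by rewrite expr0 mul1r.
by rewrite exprS -mulrA mulN1r normcN IH.
Qed.

Lemma vanish_reflect f K c : vanish_outside (- K) K f ->
  vanish_outside (c - K) (c + K) (fun y => f (c - y)).
Proof.
move=> f0 y yK; apply: f0; apply: contra yK; rewrite !in_itv /=.
by move=> /andP[? ?]; apply/andP; split; lra.
Qed.

Lemma conv_D_L1 F K c : tower F -> vanish_outside (- K) K (F 0%N) ->
  D_L1 (fun y => F 0%N (c - y)).
Proof.
move=> tF F0; rewrite -reflect_tower0.
apply: (@tower_D_L1 _ _ (c - K) (c + K)); first exact: tower_reflect.
by rewrite reflect_tower0; exact: vanish_reflect.
Qed.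

Lemma D_L1_0 : D_L1 (fun _ => 0 : R[i]^o).
Proof. by apply: (@tower_D_L1 _ _ 0 1 tower0) => x. Qed.

Section Linear.
Variables (T : functional R) (linT : linear_on_D_L1 T).

Lemma distr0 : T (fun _ => 0) = 0.
Proof.
have := linT 1 D_L1_0 D_L1_0; rewrite /= mulr0 addr0 mul1r.
by move/eqP; rewrite -subr_eq0 opprD addrA subrr sub0r oppr_eq0 => /eqP.
Qed.

Lemma distrZ c f : D_L1 f -> T (fun x => c * f x) = c * T f.
Proof.
move=> Df; have := linT c Df D_L1_0; rewrite distr0 addr0 => <-.
by congr (T _); apply/funext => x; rewrite addr0.
Qed.

Lemma distrB f g : D_L1 f -> D_L1 g -> T (fun x => f x - g x) = T f - T g.
Proof.
move=> Df Dg; have := linT (-1) Dg Df; rewrite mulN1r addrC => <-.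
by congr (T _); apply/funext => x; rewrite mulN1r addrC.
Qed.

End Linear.

(* The translates of F 0 have supports of the same length, so sup bounds control
   their norms in D_L1 uniformly in x. *)
Lemma conv_bound T (K : R) : bounded_distribution T -> 0 < K ->
  exists (m : nat) (C : R), 0 <= C /\ forall F (B : R), tower F ->
    vanish_outside (- K) K (F 0%N) -> 0 < B ->
    (forall j x, (j <= m)%N -> normc (F j x) <= B) ->
    forall x : R, normc (conv T (F 0%N) x : R[i]) <= C * B.
Proof.
move=> [linT /(_ _ D_L1_0 1 ltr01) [m [d [d0 Td]]]] K0.
have c0 : 0 < m.+1%:R * (4 * K) :> R by rewrite !mulr_gt0.
exists m, (m.+1%:R * (4 * K) / d); split; first by rewrite divr_ge0 ?ltW.
move=> F B tF F0 B0 FB x.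
(* This scaling brings the D_L1 norm of [G 0] to at most d/2: m+1 terms, sup bound rB, support of
   length 2K. Using 4K gives the strict inequality required by continuity at 0. *)
pose r := d / (m.+1%:R * (4 * K) * B).
have r0 : 0 < r by rewrite divr_gt0// mulr_gt0.
pose G j y : R[i]^o := r%:C * reflect_tower x F j y + 0.
have tG : tower G by apply: tower_lin; [exact: tower_reflect|exact: tower0].
have G0 : vanish_outside (x - K) (x + K) (G 0%N).
  by move=> y yK; rewrite /G reflect_tower0 (vanish_reflect F0 yK) mulr0 addr0.
have GB j y : (j <= m)%N -> normc (G j y) <= r * B.
  move=> jm; rewrite /G addr0 normcM normc_reflect_tower normc_real gtr0_norm//.
  by rewrite ler_wpM2l ?(ltW r0) ?FB.
have := Td (G 0%N); rewrite (_ : (fun y => G 0%N y - 0) = G 0%N); last first.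
  by apply/funext => y; rewrite subr0.
have -> : T (G 0%N) = r%:C * conv T (F 0%N) x.
  rewrite -(distrZ linT); last exact: conv_D_L1 F0.
  by congr (T _); apply/funext => y; rewrite /G reflect_tower0 addr0.
rewrite (distr0 linT) subr0 normcM normc_real gtr0_norm//.
have rB : m.+1%:R * (r * B * (x + K - (x - K))) < d.
  have E (M : R) : 0 < M ->
      M * (d / (M * (4 * K) * B) * B * (x + K - (x - K))) = d / 2.
    by move=> M0; field; rewrite !gt_eqF.
  by rewrite /r E//; lra.
have uv : x - K < x + K by lra.
move=> /(_ (tower_D_L1 tG G0) (le_lt_trans (tower_norm_D_L1_le tG uv G0 GB) rB)).
rewrite -ltr_pdivlMl// mulr1 => /ltW/le_trans; apply.
by rewrite /r invf_div mulrAC.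
Qed.

(** Increments and Taylor remainders of T * phi^(j) are convolutions of T with those of phi^(j). The
    latter have support in a fixed segment and are O(|t|) and O(t^2) together with their derivatives
    up to order m, so [conv_bound] transfers these rates. *)
Lemma conv_jet T phi p : bounded_distribution T -> test_fun phi ->
  exists C, jet p C (fun j => conv T (cderiven j phi)).
Proof.
move=> bT tphi; have [linT _] := bT; have [sphi _] := tphi.
have tP := smooth_tower sphi; have [K K0 P0] := test_fun_vanish tphi.
(* The margin 1 holds the supports of all translates by |t| <= 1. *)
have [|m [C [C0 TC]]] := conv_bound (K := K + 1) bT; first by rewrite ltr_wpDl// ltW.
pose P j := cderiven j phi.
have KK : - K <= K by lra.
(* A derivative of order i <= m of a remainder of phi^(j) is estimated through order i + j + 2. *)
have [B B0 PB] := tower_bounded (m + p + 2) tP KK P0.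
have van j := tower_vanish tP P0 j.
have D1 j c : D_L1 (fun y => P j (c - y)).
  by apply: (conv_D_L1 (F := fun i => P (i + j)%N));
    [exact: (tower_drop j tP)|exact: (van j)].
have wide f : vanish_outside (- K) K f -> vanish_outside (- (K + 1)) (K + 1) f.
  move=> f0 x xK; apply: f0; apply: contra xK; rewrite !in_itv /=.
  by move=> /andP[? ?]; apply/andP; split; lra.
have wide_shift f (t : R) : `|t| <= 1 -> vanish_outside (- K) K f ->
    vanish_outside (- (K + 1)) (K + 1) (shift_fun t f).
  rewrite ler_norml => /andP[? ?] f0 x xK; apply: f0; apply: contra xK.
  by rewrite !in_itv /= => /andP[? ?]; apply/andP; split; lra.
pose D j t i y : R[i]^o := -1 * P (i + j)%N y + shift_fun t (P (i + j)%N) y.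
have tD j t : tower (D j t).
  apply: tower_lin; first exact: (tower_drop j tP).
  exact: (tower_shift t (tower_drop j tP)).
have D0 j t : `|t| <= 1 -> vanish_outside (- (K + 1)) (K + 1) (D j t 0%N).
  move=> t1 y yK.
  rewrite /D add0n [P j y](wide _ (van j))// (wide_shift _ _ t1 (van j))//.
  by rewrite mulr0 addr0.
have convD j t x :
    conv T (P j) (x + t) - conv T (P j) x = conv T (D j t 0%N) x.
  rewrite -(distrB linT)//; congr (T _); apply/funext => y.
  by rewrite /D /shift_fun mulN1r addrC [x - y + t]addrAC.
exists (C * (2 * B)) => x; split=> j jp.
- apply: (TC (fun i => P (i + j)%N)); first exact: (tower_drop j tP).
  + exact: wide (van j).
  + by rewrite mulr_gt0.
  + move=> i y im; apply: (@le_trans _ _ B); last by lra.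
    by apply: PB; lia.
(* The case t = 0 is separate because [conv_bound] needs a positive sup bound. *)
- move=> t t1; have [->|t0] := eqVneq t 0.
    by rewrite addr0 subrr normc0 normr0 mulr0.
  rewrite convD -mulrA; apply: TC (D0 _ _ t1) _ _ _ => //.
  + by rewrite !mulr_gt0// normr_gt0.
  + move=> i y im; rewrite /D mulN1r addrC.
    by apply: (tower_lipschitz tP _ y t) => z; apply: PB; lia.
- move=> t t1; have [->|t0] := eqVneq t 0.
    by rewrite addr0 subrr mul0r subrr normc0 expr0n mulr0.
  (* The Taylor remainder of phi^(j) with its derivatives, in the shape of [tower_lin]. *)
  pose F i y : R[i]^o := - t%:C * P (i + j.+1)%N y + D j t i y.
  have tF : tower F := tower_lin (- t%:C) (tower_drop j.+1 tP) (tD j t).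
  have -> : conv T (P j) (x + t) - conv T (P j) x - t%:C * conv T (P j.+1) x =
      conv T (F 0%N) x.
    rewrite convD addrC -mulNr.
    have DD := conv_D_L1 x (tD j t) (D0 _ _ t1).
    exact: esym (linT (- t%:C) _ _ (D1 j.+1 x) DD).
  rewrite -mulrA; apply: TC => //.
  + by move=> y yK; rewrite /F add0n [P _ y](wide _ (van _))// (D0 _ _ t1)// mulr0 addr0.
  + by rewrite mulr_gt0 ?exprn_even_gt0// mulr_gt0.
  + move=> i y im; rewrite /F /D mulN1r mulNr addrC [- P _ _ + _]addrC addnS.
    by apply: (tower_taylor tP _ y t) => z; apply: PB; lia.
Qed.

(** The sign from transposing i derivatives cancels the one from differentiating the reflected test
    function, and shifting that function by -h_j moves [x] to x + h_j. *)
Lemma conv_L_distr T phi p q (a : 'I_p.+1 -> 'I_q.+1 -> R[i])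
    (h : 'I_q.+1 -> R) x :
  linear_on_D_L1 T -> test_fun phi ->
  L_distr a h T (fun y => phi (x - y)) =
  jet_op a h (fun j => conv T (cderiven j phi)) x.
Proof.
move=> linT tphi; have [sphi _] := tphi.
have tP := smooth_tower sphi; have [K K0 P0] := test_fun_vanish tphi.
apply: eq_bigr => i _; apply: eq_bigr => j _; congr (_ * _).
have iterE (U : functional R) n f :
    iter n derive_distr U f = (-1) ^+ n * U (cderiven n f).
  elim: n f => [|n IH] f; first by rewrite expr0 mul1r.
  rewrite iterS /derive_distr IH -/(derive_distr _) /cderiven -iterSr.
  by rewrite exprS mulN1r mulNr.
rewrite iterE /shift_distr.
have -> : cderiven i (fun y => phi (x - y)) = reflect_tower x (cderiven^~ phi) i.
  rewrite -[RHS](tower_cderiven i (tower_reflect x tP)).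
  rewrite -[X in _ = cderiven i X]/(reflect_tower x (cderiven^~ phi) 0%N).
  by rewrite reflect_tower0.
have -> : shift_fun (- h j) (reflect_tower x (cderiven^~ phi) i) =
    fun y => (-1) ^+ i * cderiven i phi (x + h j - y).
  by apply/funext => y; rewrite /shift_fun /reflect_tower opprD opprK addrA addrAC.
rewrite (distrZ linT); last first.
  apply: (conv_D_L1 (F := fun k => cderiven (k + i) phi)) (tower_drop i tP) _.
  exact: tower_vanish tP P0 i.
by rewrite mulrA -exprD addnn -mul2n exprM sqrrN expr1n expr1n mul1r.
Qed.

Lemma test_fun_reflect phi (x : R) : test_fun phi -> test_fun (fun y => phi (x - y)).
Proof.
move=> tphi; have [sphi _] := tphi; have [K K0 P0] := test_fun_vanish tphi.
apply: (@vanish_test_fun _ _ (x - K) (x + K)); last exact: vanish_reflect.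
have := tower_smooth (tower_reflect x (smooth_tower sphi)).
by rewrite reflect_tower0.
Qed.

End Convolution.

Unset Implicit Arguments.

Theorem theorem3 (R : realType) (p q : nat)
    (a : 'I_p.+1 -> 'I_q.+1 -> R[i]) (h : 'I_q.+1 -> R) :
  (forall f : cfun R, class_C_ub p f -> (forall x, L_fun a h f x = 0) ->
     almost_automorphic f) ->
  forall S : functional R, aa_distribution S ->
  forall T : functional R, bounded_distribution T ->
    eq_distribution (L_distr a h T) S ->
    aa_distribution T.
Proof.
move=> homog S [_ aaS] T bT LTS; split; [exact: bT|move=> phi tphi].
have [C jT] := conv_jet p bT tphi.
apply: (almost_automorphic_jet homog jT).
(* Testing the equation for T on phi(x - .) gives L_h u = v at [x]. *)
suff -> : jet_op a h (fun j => conv T (cderiven j phi)) = conv S phi by exact: aaS.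
apply/funext => x; rewrite -conv_L_distr//; last exact: bT.1.
exact: LTS (test_fun_reflect x tphi).
Qed.
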